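(* Assume the setting and notation in the context. Suppose the scores $\{T_i\}$ and residuals $\{R_i\}$ ($i\in\mathcal C\cup\mathcal U$) are continuous random variables, and the ranking threshold is $\hat\kappa=\kappa(T_i:i\in\mathcal C\cup\mathcal U)$ for a deterministic measurable $\kappa:\mathbb R^{n+m}\to\{1,\dots,m\}$ (calibration-assisted selection). For $j\in\mathcal U$, $k\in\mathcal C$ and reals $t,s$, let $\hat\kappa^{j\leftarrow t}$ be the value of $\kappa$ after replacing $T_j$ by $t$, and $\hat\kappa^{(j,k)\leftarrow(t,s)}$ the value after simultaneously replacing $T_j$ by $t$ and $T_k$ by $s$. Let $\hat{\mathcal S}_u=\{j\in\mathcal U:T_j\le T_{(\hat\kappa)}\}$ and $\hat{\mathcal S}_c^+=\{i\in\mathcal C:T_i\le T_{(\hat\kappa+1)}\}$. Assume: (A) there exist deterministic $t_u,t_c\in\mathbb R$, integers $I_u,I_c\ge0$ and $\gamma\in(0,1)$ such that almost surely: $\hat\kappa^{j\leftarrow t_u}=\hat\kappa$ for all $j\in\hat{\mathcal S}_u$; $\hat\kappa\le\hat\kappa^{j\leftarrow t_u}\le\hat\kappa+I_u$ for all $j\in\mathcal U\setminus\hat{\mathcal S}_u$; $\hat\kappa^{j\leftarrow t_u}\le\hat\kappa^{(j,k)\leftarrow(t_u,t_c)}\le\hat\kappa^{j\leftarrow t_u}+I_c$ for all $j\in\mathcal U,k\in\mathcal C$; and $\lceil\gamma m\rceil\le\hat\kappa\le m-1$; (B) letting $F_R,F_T$ be the CDFs of $R_i$ and $T_i$ and $F_{(R,T)}$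 the joint CDF of $(F_R(R_i),F_T(T_i))$, there is $\rho\in(0,1)$ with $\partial F_{(R,T)}(r,t)/\partial r\ge\rho t$ for all $t\in[\gamma/2,1]$ and $r\in(0,1)$. If $n\gamma\ge256\log n$ and $m\gamma\ge32\log m$, then the intervals $\mathrm{PI}_j=[\hat\mu(X_j)\pm Q_\alpha(\{R_i\}_{i\in\hat{\mathcal S}_c^+})]$, $j\in\hat{\mathcal S}_u$, satisfy $$\mathrm{FCR}-\alpha=O\Big\{\frac{1}{\rho\gamma^3}\Big(\frac{I_c\log m}{m}+\frac{\log n}{n}\Big)+\frac{I_u\log m}{m\gamma}\Big\},$$ i.e. $|\mathrm{FCR}-\alpha|$ is bounded by an absolute constant times the quantity in braces.
   Context: Setting: $\hat\mu:\mathbb R^d\to\mathbb R$ and $g:\mathbb R^d\to\mathbb R$ are fixed deterministic measurable functions. Calibration indices $\mathcal C$, $|\mathcal C|=n$; test indices $\mathcal U$ (disjoint), $|\mathcal U|=m$. The pairs $(X_i,Y_i)\in\mathbb R^d\times\mathbb R$, $i\in\mathcal C\cup\mathcal U$, are i.i.d. Scores $T_i=g(X_i)$, residuals $R_i=|Y_i-\hat\mu(X_i)|$, $\alpha\in(0,1)$. $T_{(r)}$ denotes the $r$-th smallest value of the test scores $\{T_i\}_{i\in\mathcal U}$. For a finite index set $S$, $Q_\alpha(\{R_i\}_{i\in S})$ is the $\lceil(1-\alpha)(|S|+1)\rceil$-th smallest value of $\{R_i\}_{i\in S}$, equal to $+\infty$ if that index exceeds $|S|$. $\mathrm{FCR}=\mathbb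 E\Big[\frac{|\{j\in\hat{\mathcal S}_u: Y_j\notin\mathrm{PI}_j\}|}{\max\{|\hat{\mathcal S}_u|,1\}}\Big]$.
   Formalization: The formal theorem assumes n ≥ 2: for n = 1 the claim fails, since log n = 0 and, with α < 1/2 and I_u = I_c = 0, the quantile is +∞, so FCR = 0 while the bound is 0. *)

(* Defs.v *)
From HB Require Import structures.
From mathcomp Require Import all_boot all_order all_algebra.
From mathcomp Require Import all_classical all_reals all_analysis.
Set Implicit Arguments. Unset Strict Implicit. Unset Printing Implicit Defensive.
Import Order.TTheory GRing.Theory Num.Theory.
Local Open Scope classical_set_scope.
Local Open Scope ring_scope.

(* Indices: calibration points are [inl i], i : 'I_n ; test points are
   [inr j], j : 'I_m.  The index type is ['I_n + 'I_m]. *)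

Section ConformalDefs.
Context {R : realType}.

Definition ordstat (m : nat) (s : 'I_m -> R) (r : nat) : R :=
  nth 0 (sort <=%R [seq s j | j <- enum 'I_m]) r.-1.

Definition replace1 {I : eqType} (v : I -> R) (j : I) (t : R) : I -> R :=
  fun i => if i == j then t else v i.

Definition stack (n m : nat) (v : 'I_n + 'I_m -> R) : (n + m).-tuple R :=
  [tuple v (fintype.split k) | k < n + m].

Definition sel_u (n m : nat) (T : 'I_n + 'I_m -> R) (kap : nat) : {set 'I_m} :=
  [set j | T (inr j) <= ordstat (fun j' => T (inr j')) kap].

Definition sel_cplus (n m : nat) (T : 'I_n + 'I_m -> R) (kap : nat) : {set 'I_n} :=
  [set i | T (inl i) <= ordstat (fun j' => T (inr j')) kap.+1].

Definition Qalpha (alpha : R) {I : finType} (S : {set I}) (r : I -> R) : \bar R :=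
  let k := Num.ceil ((1 - alpha) * (#|S|.+1)%:R) in
  if (#|S|%:Z < k)%R then +oo%E
  else (nth 0 (sort <=%R [seq r i | i in S]) (`|k|%N).-1)%:E.

Definition in_PI (c : R) (Q : \bar R) (y : R) : bool :=
  ((c%:E - Q <= y%:E) && (y%:E <= c%:E + Q))%E.

Context {d : measure_display} {Omega : measurableType d}.

Definition mutually_independent {I : finType} {dT : measure_display}
  {T : measurableType dT} (P : probability Omega R) (Z : I -> Omega -> T) :=
  forall A : I -> set T, (forall i, measurable (A i)) ->
    P (\bigcap_(i in [set: I]) (Z i @^-1` A i)) = (\prod_(i : I) P (Z i @^-1` A i))%E.

Definition identically_distributed {I : Type} {dT : measure_display}
  {T : measurableType dT} (P : probability Omega R) (Z : I -> Omega -> T) :=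
  forall i j (A : set T), measurable A -> P (Z i @^-1` A) = P (Z j @^-1` A).

Definition continuous_rv (P : probability Omega R) (Z : Omega -> R) :=
  forall t : R, P [set w | Z w = t] = 0%E.

Definition cdf (P : probability Omega R) (Z : Omega -> R) (t : R) : R :=
  fine (P [set w | Z w <= t]).

Definition joint_cdf (P : probability Omega R) (Rr Tt : Omega -> R) (r t : R) : R :=
  fine (P [set w | cdf P Rr (Rr w) <= r /\ cdf P Tt (Tt w) <= t]).

Section Model.
Variables (dd n m : nat) (alpha : R) (muhat g : dd.-tuple R -> R)
  (X : 'I_n + 'I_m -> Omega -> dd.-tuple R) (Y : 'I_n + 'I_m -> Omega -> R)
  (kappa : (n + m).-tuple R -> nat).

Definition score (i : 'I_n + 'I_m) (w : Omega) : R := g (X i w).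
Definition resid (i : 'I_n + 'I_m) (w : Omega) : R := `|Y i w - muhat (X i w)|.
Definition scores (w : Omega) : 'I_n + 'I_m -> R := fun i => score i w.

Definition khat (w : Omega) : nat := kappa (stack (scores w)).
Definition khat1 (w : Omega) (j : 'I_m) (t : R) : nat :=
  kappa (stack (replace1 (scores w) (inr j) t)).
Definition khat2 (w : Omega) (j : 'I_m) (k : 'I_n) (t s : R) : nat :=
  kappa (stack (replace1 (replace1 (scores w) (inr j) t) (inl k) s)).

Definition Su (w : Omega) : {set 'I_m} := sel_u (scores w) (khat w).
Definition Scplus (w : Omega) : {set 'I_n} := sel_cplus (scores w) (khat w).

Definition PI_thr (w : Omega) : \bar R :=
  Qalpha alpha (Scplus w) (fun i => resid (inl i) w).

Definition FCP (w : Omega) : R :=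
  #|[set j in Su w | ~~ in_PI (muhat (X (inr j) w)) (PI_thr w) (Y (inr j) w)]|%:R
  / (maxn #|Su w| 1)%:R.

Definition FCR (P : probability Omega R) : \bar R := (\int[P]_w (FCP w)%:E)%E.
End Model.
End ConformalDefs.

(* Main.v *)
(** Only exchangeability matters.  For a test index [j], let the rank of a score
    be the number of other test scores below it.  If [j] is selected, the
    calibration set consists of the points whose rank is below kappa^{j<-t_u},
    a number that does not involve [T_j]; so, up to at most [I_u] indices, the
    FCP minus alpha is the sum over [j] of a centred, weighted miscoverage
    indicator ([excess]).  Exchanging [j] with each calibration point (and with
    itself) and averaging turns its expectation into that of a leave-one-out
    count over [n + 1] points.  The cutoffs occurring in that count differ by at
    most [I_c], and a sandwich between the smallest and largest cutoff shows,
    deterministically, that the count is off by at most one plus the number of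
    points whose rank lies within [I_c] of the cutoff.  A further exchange makes
    these points test points, and at most [I_u + 4 I_c] test points have such a
    rank.  The resulting bound
      2 I_u/(gamma m) + 4 I_c/(gamma m) + I_c/(gamma^2 m) + 1/(gamma (n+1))
    implies the claim, since the factors of the latter omitted here are bounded
    below. *)

Require Import Defs.
From HB Require Import structures.
From mathcomp Require Import all_boot all_order all_algebra.
From mathcomp Require Import all_classical all_reals all_analysis.
From mathcomp Require Import fingroup perm measurable_realfun.
From mathcomp Require Import ring lra zify.
Import Order.TTheory GRing.Theory Num.Theory.
Local Open Scope classical_set_scope.
Local Open Scope ring_scope.

(** * Ranks and leave-one-out counts *)

Section Ranks.
Context {R : realType}.

(** Turns order statistics into counts, the form in which they are compared below. In the sorted
    list, the first [k] entries are at most the [k]-th and those from position [k] on are at least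
    it, so ties do no harm. *)
Lemma nth_sort_lt (s : seq R) (k : nat) (x : R) : (0 < k <= size s)%N ->
  (nth 0 (sort <=%R s) k.-1 < x) = (k <= count (fun y => (y < x)%R) s)%N.
Proof.
move=> /andP[k0 ks].
have -> : count (fun y => (y < x)%R) s = count (fun y => (y < x)%R) (sort <=%R s).
  by apply/seq.permP; rewrite perm_sym perm_sort.
set u := sort _ _.
have su : size u = size s by rewrite size_sort.
have sou : sorted <=%R u by apply: sort_sorted; exact: le_total.
have mono i j : (i <= j < size u)%N -> nth 0 u i <= nth 0 u j.
  move=> /andP[ij ju]; apply: (sorted_leq_nth le_trans lexx 0 sou) => //.
  by rewrite finset.inE (leq_ltn_trans ij).
apply/idP/idP => h.
- rewrite -(cat_take_drop k u) count_cat.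
  apply: leq_trans (leq_addr _ _).
  have -> : count (fun y => (y < x)%R) (take k u) = size (take k u).
    apply/eqP; rewrite -all_count; apply/(all_nthP 0) => i.
    rewrite size_take_min su (minn_idPl ks) => ik; rewrite nth_take//.
    by apply: le_lt_trans h; apply: mono; rewrite su; lia.
  by rewrite size_take_min su (minn_idPl ks).
- rewrite ltNge; apply/negP => hx; move: h; apply/negP; rewrite -ltnNge.
  rewrite -(cat_take_drop k.-1 u) count_cat.
  have -> : count (fun y => (y < x)%R) (drop k.-1 u) = 0%N.
    apply/eqP; rewrite -leqn0 leqNgt -has_count -all_predC.
    apply/(all_nthP 0) => i; rewrite size_drop nth_drop => ik /=.
    rewrite -leNgt (le_trans hx)//; apply: mono.
    by rewrite leq_addr/= -ltn_subRL.
  rewrite addn0 (leq_ltn_trans (count_size _ _))// size_take_min su; lia.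
Qed.

(** Take the point of smallest value among those counted: at least [x] points of [U] lie strictly
    below it, and none of them is counted. *)
Lemma card_rank_ge {O : finType} (U : {set O}) (y : O -> R) (x : R) :
  x <= #|U|%:R ->
  #|[set o in U | x <= #|[set p in U | y p < y o]|%:R]|%:R + x <= #|U|%:R.
Proof.
move=> xU; set B := [set _ in _ | _].
have [B0|[q qB]] := set_0Vmem B; first by rewrite B0 cards0 add0r.
have [ o oB omin] : exists2 o, o \in B & forall p, p \in B -> y o <= y p.
  by case: (arg_minP y qB) => o oB omin; exists o.
have oB' : x <= #|[set p in U | y p < y o]|%:R by move: oB; rewrite finset.inE => /andP[].
apply: (le_trans (lerD (lexx _) oB')).
rewrite -natrD ler_nat -leq_subRL; last first.
  by apply/subset_leq_card/fintype.subsetP => p; rewrite finset.inE => /andP[].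
have BU : B \subset U by apply/fintype.subsetP => p; rewrite finset.inE => /andP[].
rewrite -{1}(finset.setIidPr BU) -cardsD; apply/subset_leq_card/fintype.subsetP => p.
rewrite !finset.inE => /andP[pU po]; rewrite pU andbT; apply/negP => /andP[_ hp].
have : y o <= y p by apply: omin; rewrite finset.inE pU.
by rewrite leNgt po.
Qed.

(** Take the point of largest value among those counted: by injectivity all the others lie strictly
    below it, and fewer than [x] points of [U] do. *)
Lemma card_rank_lt {O : finType} (U : {set O}) (y : O -> R) (x : R) :
  injective y -> 0 <= x ->
  #|[set o in U | #|[set p in U | y p < y o]|%:R < x]|%:R <= x + 1.
Proof.
move=> yinj x0; set B := [set _ in _ | _].
have [B0|[q qB]] := set_0Vmem B; first by rewrite B0 cards0 addr_ge0.
have [ o oB omax] : exists2 o, o \in B & forall p, p \in B -> y p <= y o.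
  by case: (arg_maxP y qB) => o oB omax; exists o.
have oB' : #|[set p in U | y p < y o]|%:R < x by move: oB; rewrite finset.inE => /andP[].
rewrite (cardsD1 o) oB natrD addrC lerD2r (le_trans _ (ltW oB'))// ler_nat.
apply/subset_leq_card/fintype.subsetP => p; rewrite in_setD1 => /andP[po pB].
have := omax p pB; rewrite le_eqVlt (inj_eq yinj) (negPf po)/= => yp.
by rewrite finset.inE yp andbT; move: pB; rewrite finset.inE => /andP[].
Qed.

Definition below {O : finType} (rho : O -> nat) (k : nat) : {set O} :=
  [set p | (rho p < k)%N].

(* When [o] belongs to [S], its value exceeds the conformal quantile of
   the [#|S| - 1] other points of [S]. *)
Definition miss {O : finType} (alpha : R) (y : O -> R) (S : {set O}) (o : O) :
  bool := (1 - alpha) * #|S|%:R <= #|[set p in S | y p < y o]|%:R.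

(* All the sets [below rho (kap o)] lie between those of cutoffs [k0 - Ic] and
   [k0 + Ic]; a miss has a high rank in the larger one, a non-miss a low rank in
   the smaller one. *)
Lemma card_leave_one_out_miss {O : finType} (y : O -> R) (rho kap : O -> nat)
    (k0 Ic : nat) (alpha : R) : injective y -> 0 < alpha < 1 ->
  (forall o, (kap o <= k0 + Ic)%N) -> (forall o, (k0 <= kap o + Ic)%N) ->
  `|\sum_o (rho o < kap o)%N%:R * ((miss alpha y (below rho (kap o)) o)%:R - alpha)|
    <= #|[set o | (k0 <= rho o + Ic)%N & (rho o < k0 + Ic)%N]%SET|%:R + 1.
Proof.
move=> yinj /andP[a0 a1] kU kL.
pose S o := below rho (kap o).
set D := finset _.
(* [L] is the set of cutoff [k0 - Ic], written additively because subtraction in [nat] truncates;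
   [D] is what [U] adds to it. *)
pose L := [set o | (rho o + Ic < k0)%N]%SET; pose U := [set o | (rho o < k0 + Ic)%N]%SET.
have LS o : L \subset S o.
  by apply/fintype.subsetP => p; rewrite !finset.inE => h; have := leq_trans h (kL o); rewrite ltn_add2r.
have SU o : S o \subset U.
  by apply/fintype.subsetP => p; rewrite !finset.inE => h; exact: leq_trans h (kU o).
have UD : #|U| = (#|L| + #|D|)%N.
  rewrite -cardsUI (_ : L :&: D = finset.set0) ?cards0 ?addn0; last first.
    by apply/setP => p; rewrite !finset.inE; lia.
  by congr #|pred_of_set _|; apply/setP => p; rewrite !finset.inE; lia.
pose A := [set o | (rho o < kap o)%N & miss alpha y (S o) o]%SET.
pose B := [set o | (rho o < kap o)%N]%SET.
have LB : L \subset B.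
  by apply/fintype.subsetP => p; rewrite !finset.inE => h; have := leq_trans h (kL p); rewrite ltn_add2r.
have BU : B \subset U.
  by apply/fintype.subsetP => p; rewrite !finset.inE => h; exact: leq_trans h (kU p).
have -> : \sum_o (rho o < kap o)%N%:R * ((miss alpha y (S o) o)%:R - alpha)
    = #|A|%:R - alpha * #|B|%:R.
  rewrite -2!sum1_card !natr_sum mulr_sumr.
  rewrite [X in _ = X - _]big_mkcond [X in _ = _ - X]big_mkcond/= -sumrB; apply: eq_bigr => o _.
  by rewrite !finset.inE; case: (rho o < kap o)%N; case: (miss _ _ _ o) => /=; lra.
have cLU : #|L|%:R <= #|U|%:R :> R by rewrite ler_nat UD leq_addr.
have cLB : #|L|%:R <= #|B|%:R :> R by rewrite ler_nat subset_leq_card.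
have cBU : #|B|%:R <= #|U|%:R :> R by rewrite ler_nat subset_leq_card.
have cU : #|U|%:R = #|L|%:R + #|D|%:R :> R by rewrite UD natrD.
have L0 : 0 <= #|L|%:R :> R by [].
have hA1 : #|A|%:R + (1 - alpha) * #|L|%:R <= #|U|%:R.
  apply: le_trans (@card_rank_ge O U y ((1 - alpha) * #|L|%:R) _); last by nra.
  rewrite lerD2r ler_nat; apply/subset_leq_card/fintype.subsetP => o.
  rewrite !finset.inE => /andP[ro mo]; apply/andP; split.
    exact: leq_trans ro (kU o).
  apply: (@le_trans _ _ ((1 - alpha) * #|S o|%:R)).
    by rewrite ler_wpM2l ?subr_ge0 ?(ltW a1)// ler_nat subset_leq_card.
  apply: (le_trans mo); rewrite ler_nat.
  apply/subset_leq_card/fintype.subsetP => p; rewrite !finset.inE => /andP[h ->].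
  by rewrite andbT; exact: leq_trans h (kU o).
have hA2 : #|L|%:R <= #|A|%:R + (1 - alpha) * #|U|%:R + 1.
  have x0 : 0 <= (1 - alpha) * #|U|%:R by rewrite mulr_ge0// subr_ge0 ltW.
  rewrite -addrA; apply: le_trans (lerD (lexx _) (card_rank_lt L y _ yinj x0)).
  rewrite -natrD ler_nat.
  apply: leq_trans (leq_card_setU _ _).
  apply/subset_leq_card/fintype.subsetP => o oL; rewrite finset.in_setU.
  have := fintype.subsetP LB o oL; rewrite !finset.inE => ro.
  rewrite ro/=; have [//|mo] := boolP (miss alpha y (S o) o).
  rewrite orFb; apply/andP; split; first by move: oL; rewrite finset.inE.
  move: mo; rewrite /miss -ltNge => mo.
  apply: (@le_lt_trans _ _ #|[set p in S o | y p < y o]|%:R).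
    rewrite ler_nat; apply/subset_leq_card/fintype.subsetP => p.
    rewrite !finset.inE => /andP[h ->]; rewrite andbT.
    by have := leq_trans h (kL o); rewrite ltn_add2r.
  apply: (lt_le_trans mo).
  by rewrite ler_wpM2l ?subr_ge0 ?(ltW a1)// ler_nat subset_leq_card.
(* With [L] inside [B] inside [U], the upper bound becomes |U| - (1 - alpha)|L| - alpha |L| = |D|,
   and the lower one |L| - (1 - alpha)|U| - 1 - alpha |U| = -|D| - 1. *)
have aLB : alpha * #|L|%:R <= alpha * #|B|%:R by rewrite ler_pM2l.
have aBU : alpha * #|B|%:R <= alpha * #|U|%:R by rewrite ler_pM2l.
rewrite ler_norml; apply/andP; split; lra.
Qed.

(** Replacing each weight 1/[kap o] by the common 1/[k0] costs at most [Ic]/b^2 per point; the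
    unweighted count is then bounded by the preceding lemma. *)
Lemma sum_leave_one_out_miss {O : finType} (y : O -> R) (rho kap : O -> nat)
    (k0 Ic : nat) (alpha b : R) : injective y -> 0 < alpha < 1 -> 0 < b ->
  b <= k0%:R -> (forall o, b <= (kap o)%:R) ->
  (forall o, (kap o <= k0 + Ic)%N) -> (forall o, (k0 <= kap o + Ic)%N) ->
  `|\sum_o (rho o < kap o)%N%:R * ((miss alpha y (below rho (kap o)) o)%:R - alpha) / (kap o)%:R|
    <= (#|[set o | (k0 <= rho o + Ic)%N & (rho o < k0 + Ic)%N]%SET|%:R + 1) / b
       + #|O|%:R * (Ic%:R / b ^+ 2).
Proof.
move=> yinj a01 b0 bk0 bk kU kL; have /andP[a0 a1] := a01.
have := card_leave_one_out_miss y rho kap k0 Ic alpha yinj a01 kU kL.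
set N := #|_|.
pose u o := (rho o < kap o)%N%:R * ((miss alpha y (below rho (kap o)) o)%:R - alpha).
rewrite -/(u _) => hsum.
have k0p : 0 < k0%:R :> R by exact: lt_le_trans bk0.
have kp o : 0 < (kap o)%:R :> R by exact: lt_le_trans (bk o).
have u1 o : `|u o| <= 1.
  by rewrite /u ler_norml; case: (_ < _)%N; case: (miss _ _ _ o) => /=; apply/andP; split; lra.
have -> : \sum_o u o / (kap o)%:R = (\sum_o u o) / k0%:R
    + \sum_o u o * ((kap o)%:R^-1 - k0%:R^-1).
  rewrite mulr_suml -big_split; apply: eq_bigr => o _ /=.
  by rewrite mulrBr addrC subrK.
apply: (le_trans (ler_normD _ _)); apply: lerD.
  rewrite normrM (ger0_norm (_ : 0 <= k0%:R^-1)) ?invr_ge0 ?ler0n//.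
  by apply: ler_pM => //; rewrite ?invr_ge0 ?ler0n ?lef_pV2 ?posrE.
apply: (le_trans (ler_norm_sum _ _ _)).
rewrite mulr_natl -sumr_const; apply: ler_sum => o _.
rewrite normrM -[leRHS]mul1r; apply: ler_pM => //.
have -> : (kap o)%:R^-1 - k0%:R^-1 = (k0%:R - (kap o)%:R) / ((kap o)%:R * k0%:R) :> R.
  by field; rewrite !gt_eqF.
rewrite normrM; apply: ler_pM => //.
  rewrite ler_norml; apply/andP; split.
    by rewrite lerBrDr addrC lerBlDr -natrD ler_nat.
  by rewrite lerBlDr addrC -natrD ler_nat.
rewrite ger0_norm ?invr_ge0 ?mulr_ge0 ?ler0n// lef_pV2 ?posrE ?mulr_gt0 ?exprn_gt0//.
by rewrite expr2; apply: ler_pM => //; exact: ltW.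
Qed.
End Ranks.

(** * Maps taking finitely many values, measurably *)

Section SimpleMaps.
Context {d : measure_display} {T : measurableType d}.

(** Preimages of all subsets are required to be measurable, so the target carries no sigma-algebra
    and composition with an arbitrary function preserves the property. Sets, cutoffs and counts can
    thus be combined freely. *)
Definition simple_map {A : Type} (f : T -> A) :=
  finite_set (range f) /\ forall B : set A, measurable (f @^-1` B).

Lemma simple_map_comp {A B : Type} (h : A -> B) (f : T -> A) :
  simple_map f -> simple_map (fun x => h (f x)).
Proof.
move=> [ff mf]; split; last by move=> C; exact: mf (h @^-1` C).
by rewrite -(image_comp f h); exact: finite_image.
Qed.

Lemma simple_map_cst {A : Type} (a : A) : simple_map (fun=> a).
Proof.
split; last by move=> B; rewrite preimage_cst; case: ifP.
by apply: (sub_finite_set _ (finite_set1 a)) => _ [x _ <-].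
Qed.

Lemma simple_map_pair {A B : Type} (f : T -> A) (g : T -> B) :
  simple_map f -> simple_map g -> simple_map (fun x => (f x, g x)).
Proof.
move=> [ff mf] [fg mg]; split.
  by apply: (sub_finite_set _ (finite_setX ff fg)) => _ [x _ <-].
move=> C.
have -> : (fun x => (f x, g x)) @^-1` C = \bigcup_(a in range f)
    (f @^-1` [set a] `&` g @^-1` [set b | C (a, b)]).
  apply/seteqP; split => [x Cx|x [_ [y _ <-] [/= -> ]]]//.
  by exists (f x).
by apply: fin_bigcup_measurable => // a _; exact: measurableI.
Qed.

Lemma simple_map2 {A B C : Type} (h : A -> B -> C) (f : T -> A) (g : T -> B) :
  simple_map f -> simple_map g -> simple_map (fun x => h (f x) (g x)).
Proof.
by move=> sf sg; exact: (simple_map_comp (fun p => h p.1 p.2) _ (simple_map_pair _ _ sf sg)).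
Qed.
Arguments simple_map_comp {A B} h {f}.
Arguments simple_map_pair {A B f g}.
Arguments simple_map2 {A B C} h {f g}.

Lemma simple_map_bool (b : T -> bool) :
  measurable_fun setT b -> simple_map b.
Proof.
move=> mb; split; first exact: finite_finset.
by move=> B; rewrite -[X in measurable X]setTI; exact: mb.
Qed.

(** Each fibre is a finite intersection of preimages, and only finitely many subsets of [I]
    occur. *)
Lemma simple_map_finset {I : finType} (b : I -> T -> bool) :
  (forall i, simple_map (b i)) -> simple_map (fun x => [set i | b i x]%SET).
Proof.
move=> sb; split; first exact: finite_finset.
move=> B.
have -> : (fun x => [set i | b i x]%SET) @^-1` B = \bigcup_(S in B)
    \bigcap_(i in [set: I]) (b i @^-1` [set i \in S]).
  apply/seteqP; split => [x Bx|x [S BS bS]] /=.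
    by exists [set i | b i x]%SET => // i _ /=; rewrite finset.inE.
  suff -> : [set i | b i x]%SET = S by [].
  by apply/setP => i; rewrite finset.inE bS.
apply: fin_bigcup_measurable; first exact: finite_finset.
move=> S _; apply: fin_bigcap_measurable; first exact: finite_finset.
by move=> i _; have [_] := sb i; exact.
Qed.

Context {R : realType}.

Lemma simple_map_sum {I : Type} (r : seq I) (f : I -> T -> R) :
  (forall i, simple_map (f i)) -> simple_map (fun x => \sum_(i <- r) f i x).
Proof.
move=> sf; elim: r => [|i r IH].
  by under eq_fun do rewrite big_nil; exact: simple_map_cst.
under eq_fun do rewrite big_cons; exact: simple_map2.
Qed.

Lemma simple_map_integrable (P : probability T R) (f : T -> R) :
  simple_map f -> P.-integrable setT (EFin \o f).
Proof.
move=> [ff mf]; apply: measurable_bounded_integrable => //.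
- by apply: (@le_lt_trans _ _ 1%E); [exact: probability_le1|rewrite ltry].
- by move=> _ B mB; rewrite setTI; exact: mf.
- have /finite_seqP[s fs] := ff.
  exists (\sum_(y <- s) `|y|); split; first exact: num_real.
  move=> y sy x _; apply: ltW; apply: le_lt_trans sy.
  have : range f (f x) by exists x.
  rewrite fs /= => fxs; rewrite (big_rem _ fxs)/= lerDl.
  by apply: sumr_ge0.
Qed.

Lemma Rintegral_simple_sum (P : probability T R) {I : Type} (r : seq I)
    (f : I -> T -> R) : (forall i, simple_map (f i)) ->
  \int[P]_x (\sum_(i <- r) f i x) = \sum_(i <- r) \int[P]_x f i x.
Proof.
move=> sf; elim: r => [|i r IH].
  under eq_Rintegral do rewrite big_nil.
  by rewrite Rintegral_cst// mul0r big_nil.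
under eq_Rintegral do rewrite big_cons.
rewrite RintegralD ?big_cons ?IH//; apply: simple_map_integrable => //.
exact: simple_map_sum.
Qed.

Lemma ae_le_Rintegral_simple (P : probability T R) (f g : T -> R) :
  simple_map f -> simple_map g -> {ae P, forall x, f x <= g x} ->
  \int[P]_x f x <= \int[P]_x g x.
Proof.
move=> sf sg fg.
(* The minimum equals [f] almost everywhere and is at most [g] everywhere, so pointwise monotonicity
   of the integral applies. *)
pose h x := Num.min (f x) (g x).
have sh : simple_map h by exact: simple_map2.
have mE (k : T -> R) : simple_map k -> measurable_fun setT (EFin \o k).
  move=> [_ mk]; apply/measurable_EFinP => _ B mB; rewrite setTI; exact: mk.
have -> : \int[P]_x f x = \int[P]_x h x.
  congr fine; apply: ae_eq_integral => //; [exact: mE|exact: mE|].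
  by apply: filterS fg => x fgx _; rewrite /h min_l.
apply: le_Rintegral => //; try exact: simple_map_integrable.
by move=> x _; rewrite /h ge_min lexx orbT.
Qed.

Lemma ae_norm_le_Rintegral_simple (P : probability T R) (f g : T -> R) :
  simple_map f -> simple_map g -> {ae P, forall x, `|f x| <= g x} ->
  `|\int[P]_x f x| <= \int[P]_x g x.
Proof.
move=> sf sg fg; apply: (@le_trans _ _ (\int[P]_x `|f x|)).
  by apply: le_normr_Rintegral => //; exact: simple_map_integrable.
by apply: ae_le_Rintegral_simple => //; exact: simple_map_comp.
Qed.

Lemma Rintegral_prob_cst (P : probability T R) (c : R) : \int[P]_x c = c.
Proof. by rewrite Rintegral_cst// [X in fine X]probability_setT mulr1. Qed.

End SimpleMaps.
Arguments simple_map_comp {d T A B} h {f}.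
Arguments simple_map_pair {d T A B f g}.
Arguments simple_map2 {d T A B C} h {f g}.
Arguments simple_map_finset {d T I b}.
Arguments simple_map_integrable {d T R} P {f}.

Lemma simple_map_preimage {d d'} {T : measurableType d} {T' : measurableType d'}
    {A : Type} (f : T -> A) (g : T' -> T) :
  measurable_fun setT g -> simple_map f -> simple_map (fun x => f (g x)).
Proof.
move=> mg [ff mf]; split.
  by apply: (sub_finite_set _ ff) => _ [x _ <-]; exists (g x).
by move=> B; rewrite -[X in measurable X]setTI; exact: (mg _ _ (mf B)).
Qed.

(** * Product sigma-algebra and exchangeability *)

Section ProductSpace.
Context {I : finType} {d : measure_display} {T : measurableType d}.

Definition rect (A : I -> set T) : set (I -> T) := [set z | forall i, A i (z i)].

Definition rects : set (set (I -> T)) :=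
  [set E | exists2 A, (forall i, measurable (A i)) & E = rect A].

(** The product sigma-algebra on [I -> T], generated by the measurable rectangles. *)
Definition config := g_sigma_algebraType rects.

Lemma measurable_rect (A : I -> set T) : (forall i, measurable (A i)) ->
  measurable (rect A : set config).
Proof. by move=> mA; apply: sub_sigma_algebra; exists A. Qed.

Lemma measurable_coord (i : I) : measurable_fun setT (fun z : config => z i).
Proof.
move=> _ B mB; rewrite setTI.
have -> : (fun z : config => z i) @^-1` B
    = rect (fun j => if j == i then B else setT).
  apply/seteqP; split => z /= zB; last by have := zB i; rewrite eqxx.
  by move=> j; case: eqVneq => // ->.
by apply: measurable_rect => j; case: ifP.
Qed.

Lemma measurable_to_config {d'} {W : measurableType d'} (f : W -> config) :
  (forall i, measurable_fun setT (fun w => f w i)) -> measurable_fun setT f.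
Proof.
move=> mf; apply: (@measurability _ _ _ config setT f rects erefl) => _ [_ [A mA ->] <-].
rewrite setTI.
have -> : f @^-1` rect A = \bigcap_(i in [set: I]) ((fun w => f w i) @^-1` A i).
  by apply/seteqP; split => w /= h; [move=> i _; exact: h|move=> i; exact: h].
apply: fin_bigcap_measurable; first exact: finite_finset.
by move=> i _; rewrite -[X in measurable X]setTI; exact: mf.
Qed.

Definition permute (s : {perm I}) (z : config) : config := fun i => z (s i).

Lemma measurable_permute (s : {perm I}) : measurable_fun setT (permute s).
Proof. by apply: measurable_to_config => i; exact: measurable_coord. Qed.

(** Rectangles are closed under intersection and include the whole space, so a finite measure is
    determined by its values on them. *)
Lemma measure_config_unique {R : realType}
    (m1 m2 : probability config R) :
  (forall A, (forall i, measurable (A i)) -> m1 (rect A) = m2 (rect A)) ->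
  forall E, measurable E -> m1 E = m2 E.
Proof.
move=> m12 E mE.
apply: (@g_sigma_algebra_measure_unique _ R config rects _ (fun=> rect (fun=> setT))
  _ _ m1 m2) => //.
- by move=> _ [A mA ->]; exact: measurable_rect.
- by move=> _; exists (fun=> setT).
- by apply/seteqP; split => // z _; exists 0%N.
- move=> _ _ [A mA ->] [B mB ->]; exists (fun i => A i `&` B i).
    by move=> i; exact: measurableI.
  apply/seteqP; split => z; first by move=> [zA zB] i; split; [exact: zA|exact: zB].
  by move=> h; split => i; have [] := h i.
- by move=> _ [A mA ->]; exact: m12.
- move=> _; apply: (@le_lt_trans _ _ 1%E); last by rewrite ltry.
  by apply: probability_le1; exact: measurable_rect.
Qed.

End ProductSpace.
Arguments config : clear implicits.

Section IndependentFamily.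
Context {R : realType} {I : finType} {d d' : measure_display}
  {Omega : measurableType d} {T : measurableType d'} {P : probability Omega R}.

(** It suffices to compare the two laws on rectangles. There, permuting the coordinates permutes the
    sides by the inverse permutation; independence gives a product over the sides, and identical
    distribution lets the factors be reindexed. *)
Lemma exchangeable_iid (Z : {mfun Omega >-> config I d' T}) (s : {perm I}) :
  mutually_independent P (fun i w => Z w i) ->
  identically_distributed P (fun i w => Z w i) ->
  forall E : set (config I d' T), measurable E ->
    P (Z @^-1` E) = P (Z @^-1` (permute s @^-1` E)).
Proof.
move=> indep ident.
pose SZ : {mfun Omega >-> config I d' T} :=
  HB.pack (permute s \o Z) (isMeasurableFun.Build _ _ _ _ (permute s \o Z)
    (measurableT_comp (measurable_permute s) (measurable_funPT Z))).
apply: (measure_config_unique (distribution P Z) (distribution P SZ)) => A mA.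
rewrite /distribution /pushforward /=.
transitivity (P (\bigcap_(i in [set: I]) ((fun w => Z w i) @^-1` A i))).
  by congr (P _); apply/seteqP; split => w /= h; [move=> i _; exact: h|move=> i; exact: h].
transitivity (P (\bigcap_(i in [set: I]) ((fun w => Z w i) @^-1` A ((s^-1)%g i)))).
  rewrite !indep//; rewrite [RHS](reindex_inj (@perm_inj _ s))/=; apply: eq_bigr => i _.
  by rewrite permK; exact: ident.
congr (P _); apply/seteqP; split => w /= h.
  by move=> i; have := h (s i) Logic.I; rewrite /= permK.
by move=> i _ /=; have := h ((s^-1)%g i); rewrite /permute /= permKV.
Qed.

(** The law of the pair is the product of the marginals, and every section of the diagonal is a
    single point, null by continuity of [Z j]. *)
Lemma independent_pair_neq (Z : I -> Omega -> R) (i j : I) : i != j ->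
  (forall k, measurable_fun setT (Z k)) ->
  mutually_independent P Z -> continuous_rv P (Z j) ->
  P [set w | Z i w = Z j w] = 0%E.
Proof.
move=> ij mZ indep cont.
pose X k : {mfun Omega >-> R} :=
  HB.pack (Z k) (isMeasurableFun.Build _ _ _ _ (Z k) (mZ k)).
have mXX : measurable_fun setT (fun w => (Z i w, Z j w)).
  by apply: measurable_fun_pair.
pose XX : {mfun Omega >-> (R * R)%type} :=
  HB.pack (fun w => (Z i w, Z j w)) (isMeasurableFun.Build _ _ _ _ _ mXX).
have mD : measurable [set p : R * R | p.1 = p.2].
  rewrite (_ : [set _ | _] = [set p : R * R | p.1 == p.2]); last first.
    by apply/seteqP; split => p /= /eqP.
  have := @measurable_fun_eqr _ (R * R)%type R setT fst snd.
  move=> /(_ measurable_fst measurable_snd measurableT [set true] Logic.I).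
  by rewrite setTI.
have -> : P [set w | Z i w = Z j w] = distribution P XX [set p | p.1 = p.2] by [].
rewrite -(@product_measure_unique _ _ R R R (distribution P (X i)) (distribution P (X j))
  (distribution P XX)) => //.
  rewrite /product_measure1 (eq_integral (fun=> 0%E)) ?integral0// => x _ /=.
  rewrite -(cont x) /distribution /pushforward /=; congr (P _).
  apply/seteqP; split => w /=; rewrite /xsection /= ?inE /=.
    by move=> /set_mem /= ->.
  by move=> ->; apply/mem_set.
move=> A B mA mB.
(* Full sides at all other indices contribute factors 1, which extracts the product rule for the
   pair. *)
have := indep (fun k => if k == i then A else if k == j then B else setT).
rewrite (bigD1 i)//= (bigD1 j) 1?eq_sym//= big1; last first.
  by move=> k /andP[/negPf -> /negPf ->]; rewrite preimage_setT probability_setT.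
rewrite eqxx (eq_sym j i) (negPf ij) eqxx mule1 => <-; last first.
  by move=> k; case: ifP => // _; case: ifP.
congr (P _); apply/seteqP; split => w /=.
  move=> [/= Aw Bw] k _ /=; case: eqVneq => [->//|_].
  by case: eqVneq => [->|].
move=> h; split; first by have := h i Logic.I; rewrite /= eqxx.
by have := h j Logic.I; rewrite /= (eq_sym j i) (negPf ij) eqxx.
Qed.

End IndependentFamily.

(** * Counting test and calibration points *)

Section Counting.
Context {R : realType}.

Lemma count_enum {I : finType} (S : {set I}) (a : pred I) :
  count a (enum S) = #|[set i in S | a i]%SET|.
Proof.
rewrite -sum1_count big_enum_cond /= -sum1_card.
by apply: eq_bigl => i; rewrite finset.inE.
Qed.

Lemma le_ordstat {m : nat} (s : 'I_m -> R) (k : nat) (x : R) :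
  (0 < k <= m)%N -> (x <= ordstat s k) = (#|[set l | (s l < x)%R]%SET| < k)%N.
Proof.
move=> km; rewrite leNgt nth_sort_lt; last by rewrite size_map size_enum_ord.
rewrite -ltnNge count_map; congr (_ < _)%N.
rewrite enumT -enum_setT count_enum.
by apply: eq_card => l; rewrite !finset.inE.
Qed.

(** Both cases of the quantile fit one inequality: if the ceiling exceeds |S|, the quantile is
    infinite, and the count, at most |S|, cannot reach the ceiling. *)
Lemma Qalpha_lt (alpha : R) {I : finType} (S : {set I}) (r : I -> R) (x : R) :
  0 < alpha < 1 ->
  (Qalpha alpha S r < x%:E)%E
    = ((1 - alpha) * (#|S|.+1)%:R <= #|[set i in S | (r i < x)%R]%SET|%:R).
Proof.
move=> /andP[a0 a1]; rewrite /Qalpha; set c := #|finset _|.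
have cS : (c <= #|S|)%N.
  by apply/subset_leq_card/fintype.subsetP => i; rewrite finset.inE => /andP[].
have q0 : 0 < (1 - alpha) * (#|S|.+1)%:R by rewrite mulr_gt0 ?subr_gt0.
have E (j : nat) : ((1 - alpha) * (#|S|.+1)%:R <= j%:R)
    = (Num.ceil ((1 - alpha) * (#|S|.+1)%:R) <= j%:Z).
  by rewrite ceil_le_int.
rewrite E; set k := Num.ceil _; have k0 : 0 < k by rewrite ceil_gt0.
case: ifPn => [h|]; last rewrite -leNgt => h.
  rewrite ltNge leey/=; apply/esym/negbTE; rewrite -ltNge.
  by apply: le_lt_trans h; rewrite lez_nat.
have kE : k = `|k|%N by rewrite gez0_abs// ltW.
rewrite lte_fin nth_sort_lt; last first.
  by rewrite size_map -cardE; apply/andP; split; lia.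
rewrite count_map [X in (_ <= X)%N](_ : _ = c); first by rewrite {2}kE lez_nat.
exact: count_enum.
Qed.

Lemma card_set_option {I : finType} (a : pred (option I)) :
  #|[set o | a o]%SET| = (a None + #|[set i | a (Some i)]%SET|)%N.
Proof.
have Sinj : injective (@Some I) by move=> ? ? [].
rewrite (cardsD1 None) finset.inE; congr (_ + _)%N.
rewrite -(card_imset _ Sinj); apply: eq_card => -[i|].
  by rewrite !finset.inE /= mem_imset ?finset.inE.
rewrite !finset.inE /=; apply/esym/negbTE/negP => /imsetP[i _] //.
Qed.

(** Without ties, the rank is an injective map of ['I_m] into itself, hence a bijection. *)
Lemma rank_bij {m : nat} (s : 'I_m -> R) (b : pred nat) : injective s ->
  #|[set j | b #|[set l | (s l < s j)%R]%SET|]%SET| = #|[set j : 'I_m | b j]%SET|.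
Proof.
move=> sinj; pose r j := #|[set l | (s l < s j)%R]%SET|.
have rm j : (r j < m)%N.
  rewrite -[X in (_ < X)%N]card_ord -cardsT; apply: proper_card.
  apply/properP; split; first exact: finset.subsetT.
  by exists j; rewrite ?finset.inE// ltxx.
have rlt i j : s i < s j -> (r i < r j)%N.
  move=> ij; apply: proper_card; apply/properP; split.
    by apply/fintype.subsetP => l; rewrite !finset.inE => h; exact: lt_trans ij.
  by exists i; rewrite finset.inE ?ltxx.
pose f j := Ordinal (rm j).
have finj : injective f.
  move=> i j [] ij; apply: sinj; apply/eqP; rewrite eq_le !leNgt.
  by apply/andP; split; apply/negP => /rlt; rewrite ij ltnn.
rewrite -[RHS](card_preimset _ finj); apply: eq_card => j.
by rewrite !finset.inE.
Qed.

Lemma card_ord_itv (m a b : nat) :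
  (#|[set j : 'I_m | (a <= j < b)%N]%SET| <= b - a)%N.
Proof.
have [ab|ba] := leqP a b; last first.
  rewrite eq_card0// => j; apply/negbTE; rewrite finset.inE.
  by apply/negP => /andP[aj jb]; lia.
rewrite -[X in (_ <= X)%N](size_iota a) cardE.
rewrite -(size_map (@nat_of_ord m)); apply: uniq_leq_size.
  by rewrite map_inj_uniq ?enum_uniq//; exact: ord_inj.
move=> _ /mapP[j + ->]; rewrite mem_enum finset.inE mem_iota; lia.
Qed.

Lemma card_ord_lt (m k : nat) : (k <= m)%N -> #|[set j : 'I_m | (j < k)%N]%SET| = k.
Proof.
move=> km; rewrite -[RHS](card_ord k) -cardsT.
have winj : injective (widen_ord km) by move=> i j /(congr1 val) /= /val_inj.
rewrite -(card_imset _ winj); apply: eq_card => j.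
rewrite finset.inE; apply/idP/imsetP => [jk|[i _ ->]]; last exact: (ltn_ord i).
by exists (Ordinal jk) => //; apply: val_inj.
Qed.

End Counting.

(** * Pointwise estimates under exchange of a test point with calibration points *)

Section Core.
Context {R : realType} {n m : nat}.
Variables (alpha t_u t_c : R) (kappa : (n + m).-tuple R -> nat).
Hypothesis alpha01 : 0 < alpha < 1.
Hypothesis kappa_range : forall v, (1 <= kappa v <= m)%N.

Local Notation Z := (config ('I_n + 'I_m)%type _ (R * R)%type).
Implicit Types (z : Z) (j : 'I_m) (o : option 'I_n) (x : R).

Definition sc z : 'I_n + 'I_m -> R := fun i => (z i).1.
Definition rs z : 'I_n + 'I_m -> R := fun i => (z i).2.

Definition K0 z : nat := kappa (stack (sc z)).
Definition K1 z j : nat := kappa (stack (replace1 (sc z) (inr j) t_u)).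
Definition K2 z j k : nat :=
  kappa (stack (replace1 (replace1 (sc z) (inr j) t_u) (inl k) t_c)).

(** Leaving out [j] frees the rank function from the score of [j]; an exchange of [j] with a
    calibration point therefore preserves it. *)
Definition rk z j x : nat := #|[set l | (l != j) && (sc z (inr l) < x)]%SET|.

(* [None] stands for the test point [j], so that [option 'I_n] indexes the
   [n + 1] points which are exchanged with each other. *)
Definition pt j o : 'I_n + 'I_m := if o is Some k then inl k else inr j.
Definition swap j o z : Z := permute (tperm (inr j) (pt j o)) z.

Definition lr z j o : nat := rk z j (sc z (pt j o)).
Definition lres z j o : R := rs z (pt j o).

(* (1{R_o > quantile of the others below the cutoff k} - alpha)/k on the event that
   the rank of the point [o] is below [k]. *)
Definition excess z j (k : nat) o : R :=
  (lr z j o < k)%N%:R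
    * ((miss alpha (lres z j) (below (lr z j) k) o)%:R - alpha) / k%:R.

Lemma pt_inj j : injective (pt j).
Proof. by move=> [k|] [l|] //= [->]. Qed.

Lemma permute1 z : permute 1%g z = z.
Proof. by apply/funext => i; rewrite /permute perm1. Qed.

Lemma swap_None j z : swap j None z = z.
Proof. by rewrite /swap tperm1 permute1. Qed.

Lemma rk_swap j o z : rk (swap j o z) j = rk z j.
Proof.
apply/funext => x; apply: eq_card => l; rewrite !finset.inE.
case: eqVneq => //= lj.
have jl : inr j != inr l :> 'I_n + 'I_m by apply: contra_neq lj => -[].
by rewrite /sc /swap /permute tpermD//; case: o.
Qed.

Lemma pt_swap j o p : tperm (inr j) (pt j o) (pt j p) = pt j (tperm None o p).
Proof.
have -> : inr j = pt j None by [].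
by rewrite -inj_tperm//; exact: pt_inj.
Qed.

(** [K2] overwrites exactly the two scores that the exchange moves. *)
Lemma K2_swap j k z : K2 (swap j (Some k) z) j k = K2 z j k.
Proof.
rewrite /K2; congr (kappa (stack _)); apply/funext => i.
rewrite /replace1; case: eqVneq => // ik; case: eqVneq => // ij.
by rewrite /sc /swap /permute tpermD// eq_sym.
Qed.

(** For a fixed cutoff, the exchange acts on the [n + 1] labels by the transposition of [None] and
    [o]; ranks and residuals are merely relabelled, so all counts are preserved. *)
Lemma excess_swap z j o k : excess (swap j o z) j k None = excess z j k o.
Proof.
have lrE p : lr (swap j o z) j p = lr z j (tperm None o p).
  by rewrite /lr rk_swap /sc /swap /permute pt_swap.
have lresE p : lres (swap j o z) j p = lres z j (tperm None o p).
  by rewrite /lres /rs /swap /permute pt_swap.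
have tinj := @perm_inj _ (tperm None o).
rewrite /excess lrE tpermL; congr (_ * ((nat_of_bool _)%:R - _) / _).
rewrite /miss lresE tpermL; congr (_ * _%:R <= _%:R).
  rewrite -[RHS](card_preimset _ tinj); apply: eq_card => p.
  by rewrite !finset.inE lrE.
rewrite -[RHS](card_preimset _ tinj); apply: eq_card => p.
by rewrite !finset.inE lrE lresE.
Qed.

Definition selu z : {set 'I_m} := sel_u (sc z) (K0 z).
Definition selc z : {set 'I_n} := sel_cplus (sc z) (K0 z).

(** The false coverage proportion as a function of scores and residuals alone; [not_in_PI] provides
    the translation. *)
Definition fcp z : R :=
  #|[set j in selu z |
      (Qalpha alpha (selc z) (fun i => rs z (inl i)) < (rs z (inr j))%:E)%E]%SET|%:R
  / (maxn #|selu z| 1)%:R.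

(* The cutoff is the one with [T_k] replaced by [t_c], which makes the event
   depend on the point [k] only through [x]. *)
Definition near_rank (Ic : nat) z j o x : bool :=
  let k := if o is Some i then K2 z j i else K1 z j in
  (k <= rk z j x + Ic.*2)%N && (rk z j x < k + Ic)%N.

(** Assumption (A) at a single configuration, with a real lower bound [b] in the role of gamma m. *)
Definition stable (b : R) (Iu Ic : nat) z : Prop :=
  (forall j, j \in selu z -> K1 z j = K0 z) /\
  (forall j, j \notin selu z -> (K0 z <= K1 z j <= K0 z + Iu)%N) /\
  (forall j k, (K1 z j <= K2 z j k <= K1 z j + Ic)%N) /\
  b <= (K0 z)%:R /\ (K0 z <= m.-1)%N.

Lemma near_rank_swap Ic z j o x : near_rank Ic (swap j o z) j o x = near_rank Ic z j o x.
Proof.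
by rewrite /near_rank rk_swap; case: o => [k|]; rewrite ?K2_swap ?swap_None.
Qed.

Lemma sc_swap z j o : sc (swap j o z) (inr j) = sc z (pt j o).
Proof. by rewrite /sc /swap /permute tpermL. Qed.

Lemma rk_test z j :
  rk z j (sc z (inr j)) = #|[set l | (sc z (inr l) < sc z (inr j))%R]%SET|.
Proof.
apply: eq_card => l; rewrite !finset.inE; case: eqVneq => //= ->.
by rewrite ltxx.
Qed.

Lemma mem_selu z j : (j \in selu z) = (rk z j (sc z (inr j)) < K0 z)%N.
Proof. by rewrite finset.inE le_ordstat ?rk_test//; exact: kappa_range. Qed.

(** The bound for [i] is the order statistic of index [K0 z + 1]. If the score of [j] lies below
    that of [i], then [j] itself accounts for the extra 1; otherwise the rank of [i] is at most that
    of [j], which is below [K0 z], and both sides hold. *)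
Lemma mem_selc z j i : (K0 z <= m.-1)%N -> j \in selu z ->
  (i \in selc z) = (rk z j (sc z (inl i)) < K0 z)%N.
Proof.
clear alpha alpha01 => Km; rewrite mem_selu => hj; have /andP[K0p _] := kappa_range (stack (sc z)).
rewrite finset.inE le_ordstat; last by rewrite ltnS leq0n/=; lia.
set x := sc z (inl i); rewrite ltnS (cardsD1 j) finset.inE.
rewrite (_ : #|_ :\ j| = rk z j x); last first.
  by apply: eq_card => l; rewrite !finset.inE.
have [_|xj] := ltP (sc z (inr j)) x; first by rewrite add1n.
have h : (rk z j x <= rk z j (sc z (inr j)))%N.
  apply/subset_leq_card/fintype.subsetP => l; rewrite !finset.inE.
  by move=> /andP[-> h]; exact: lt_le_trans xj.
by rewrite add0n (leq_ltn_trans h hj) (leq_trans h (ltnW hj)).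
Qed.

(** The set below the cutoff consists of [j] and the selected calibration points. Its size is thus
    the |S| + 1 of the quantile index, and [j] does not lie below itself. *)
Lemma miss_selc z j : (K0 z <= m.-1)%N -> j \in selu z ->
  miss alpha (lres z j) (below (lr z j) (K0 z)) None
    = (Qalpha alpha (selc z) (fun i => rs z (inl i)) < (rs z (inr j))%:E)%E.
Proof.
move=> Km ju; rewrite Qalpha_lt// /miss /below.
rewrite card_set_option -mem_selu ju add1n; congr (_ * _.+1%:R <= _%:R).
  by apply: eq_card => i; rewrite [RHS](mem_selc z j)// finset.inE.
rewrite card_set_option !finset.inE ltxx andbF add0n; apply: eq_card => i.
by rewrite [RHS]finset.inE (mem_selc z j)// !finset.inE.
Qed.

(** For selected [j] the cutoffs [K1] and [K0] agree and so do the summands. An unselected [j]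
    contributes at most 1/b, and only if its rank lies in [K0, K0 + Iu), which happens for at most
    [Iu] test points. *)
Lemma fcp_excess (b : R) Iu Ic z : 0 < b -> stable b Iu Ic z ->
  injective (sc z) ->
  `|fcp z - alpha - \sum_j excess z j (K1 z j) None| <= Iu%:R / b.
Proof.
move=> b0 [Hin [Hout [_ [bK Km]]]] scinj; have /andP[a0 a1] := alpha01.
have tinj : injective (fun l => sc z (inr l)) by move=> i j /scinj[].
have /andP[Kp KM] := kappa_range (stack (sc z)); rewrite -/(K0 z) in Kp KM.
(* Since test scores have no ties, exactly [K0 z] points are selected. *)
have cu : #|selu z| = K0 z.
  rewrite -[RHS](card_ord_lt _ _ KM) -(rank_bij _ (fun r => r < K0 z)%N tinj).
  by apply: eq_card => j; rewrite mem_selu rk_test finset.inE.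
have K0R : 0 < (K0 z)%:R :> R by rewrite ltr0n.
pose q j := (Qalpha alpha (selc z) (fun i => rs z (inl i)) < (rs z (inr j))%:E)%E.
have -> : fcp z - alpha
    = \sum_j (j \in selu z)%:R * ((q j)%:R - alpha) / (K0 z)%:R.
  transitivity ((\sum_(j in selu z) ((q j)%:R - alpha)) / (K0 z)%:R); last first.
    rewrite mulr_suml big_mkcond; apply: eq_bigr => j _.
    by case: ifP => _; rewrite ?mul1r ?mul0r.
  rewrite sumrB sumr_const cu mulrBl -[alpha *+ _]mulr_natr mulfK ?gt_eqF//.
  congr (_ / _ - _); last by rewrite cu (maxn_idPl Kp).
  rewrite -sum1_card natr_sum [LHS]big_mkcond [RHS]big_mkcond.
  by apply: eq_bigr => j _; rewrite finset.inE /q; case: (_ \in _) => //=; case: ifP.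
rewrite -sumrB; apply: (le_trans (ler_norm_sum _ _ _)).
apply: (@le_trans _ _
    (\sum_j (K0 z <= rk z j (sc z (inr j)) < K0 z + Iu)%N%:R / b)).
  apply: ler_sum => j _; rewrite /excess /lr /=.
  have [ju|jnu] := boolP (j \in selu z).
    rewrite (Hin _ ju) -mem_selu ju miss_selc// subrr normr0.
    by rewrite mulr_ge0// invr_ge0 ltW.
  have /andP[h1 h2] := Hout _ jnu.
  rewrite mul0r mul0r sub0r normrN -mulrA normrM ger0_norm//.
  move: jnu; rewrite mem_selu -leqNgt => jnu; rewrite jnu /=.
  case: (ltnP _ (K1 z j)) => hj; last by rewrite mul0r mulr_ge0// invr_ge0 ltW.
  rewrite (leq_trans hj h2) ler_wpM2l// -[b^-1]mul1r normrM.
  have bK1 : b <= (K1 z j)%:R by apply: (le_trans bK); rewrite ler_nat.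
  apply: ler_pM => //.
    by rewrite ler_norml; case: (miss _ _ _ _) => /=; apply/andP; split; lra.
  have K1p : 0 < (K1 z j)%:R :> R by exact: lt_le_trans bK1.
  by rewrite ger0_norm ?invr_ge0 ?ler0n// lef_pV2.
rewrite -mulr_suml ler_pM2r ?invr_gt0//.
rewrite (_ : \sum_j _ = #|[set j | (K0 z <=
    #|[set l | (sc z (inr l) < sc z (inr j))%R]%SET| < K0 z + Iu)%N]%SET|%:R).
  rewrite (rank_bij _ (fun r => (K0 z <= r < K0 z + Iu)%N) tinj) ler_nat.
  by apply: leq_trans (card_ord_itv _ _ _) _; rewrite addKn.
rewrite -sum1_card natr_sum [RHS]big_mkcond; apply: eq_bigr => j _.
by rewrite finset.inE rk_test; case: ifP.
Qed.

(** The cutoffs [K1] before and after an exchange with [k] both lie within [Ic] below the invariant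
    [K2 z j k], hence within [Ic] of each other. *)
Lemma sum_excess_swap (b : R) Iu Ic z j : 0 < b ->
  (forall o, stable b Iu Ic (swap j o z)) -> injective (rs z) ->
  `|\sum_o excess (swap j o z) j (K1 (swap j o z) j) None|
    <= (\sum_o (near_rank Ic z j o (sc z (pt j o)))%:R + 1) / b
       + (n.+1)%:R * (Ic%:R / b ^+ 2).
Proof.
move=> b0 st rinj; under eq_bigr do rewrite excess_swap.
have bK1 o : b <= (K1 (swap j o z) j)%:R.
  have [Hin [Hout [_ [bK _]]]] := st o; apply: (le_trans bK); rewrite ler_nat.
  have [ju|jnu] := boolP (j \in selu (swap j o z)); first by rewrite Hin.
  by have /andP[] := Hout _ jnu.
have hK2 k : (K1 z j <= K2 z j k <= K1 z j + Ic)%N.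
  by have [_ [_ [+ _]]] := st None; rewrite swap_None.
have kU o : (K1 (swap j o z) j <= K1 z j + Ic)%N.
  case: o => [k|]; last by rewrite swap_None leq_addr.
  have [_ [_ [/(_ j k) + _]]] := st (Some k); rewrite K2_swap.
  by have /andP[_ h] := hK2 k; move=> /andP[h' _]; exact: leq_trans h.
have kL o : (K1 z j <= K1 (swap j o z) j + Ic)%N.
  case: o => [k|]; last by rewrite swap_None leq_addr.
  have [_ [_ [/(_ j k) + _]]] := st (Some k); rewrite K2_swap.
  by have /andP[h _] := hK2 k; move=> /andP[_ h']; exact: leq_trans h'.
have yinj : injective (lres z j) by move=> o p /rinj /pt_inj.
apply: (le_trans (sum_leave_one_out_miss _ (lr z j) _ _ Ic alpha b yinj alpha01 b0
  _ bK1 kU kL)); first by have := bK1 None; rewrite swap_None.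
rewrite card_option card_ord lerD2r ler_pM2r ?invr_gt0// lerD2r.
rewrite -sum1_card natr_sum big_mkcond; apply: ler_sum => o _.
rewrite finset.inE; case: ifP => // /andP[h1 h2].
(* Passing from [K1] to [K2] raises the cutoff by up to [Ic], which explains the doubled lower
   margin in [near_rank]. *)
rewrite /near_rank -/(lr z j o); case: o h1 h2 => [k|] h1 h2 /=.
  have /andP[h3 h4] := hK2 k.
  have -> : (K2 z j k <= lr z j (Some k) + Ic.*2)%N by lia.
  by rewrite (leq_trans h2) ?leq_add2r.
have -> : (K1 z j <= lr z j None + Ic.*2)%N.
  by rewrite (leq_trans h1)// leq_add2l -addnn leq_addr.
by rewrite h2.
Qed.

Lemma sum_near_rank (b : R) Iu Ic z o : stable b Iu Ic z -> injective (sc z) ->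
  \sum_j (near_rank Ic z j o (sc z (inr j)))%:R <= (Iu + 4 * Ic)%N%:R :> R.
Proof.
clear alpha alpha01 kappa_range => -[Hin [Hout [HK _]]] scinj.
have tinj : injective (fun l => sc z (inr l)) by move=> i j /scinj[].
have hK1 j : (K0 z <= K1 z j <= K0 z + Iu)%N.
  have [ju|jnu] := boolP (j \in selu z); last exact: Hout.
  by rewrite Hin// leqnn leq_addr.
(* Every cutoff lies in [K0, K0 + Iu + Ic], so the ranks concerned lie in an interval of length at
   most Iu + 4 Ic; truncation of the subtraction only shortens it. *)
apply: (@le_trans _ _ #|[set j | (K0 z - Ic.*2 <=
    #|[set l | (sc z (inr l) < sc z (inr j))%R]%SET|
     < K0 z + Iu + Ic.*2)%N]%SET|%:R).
  rewrite -sum1_card natr_sum [leRHS]big_mkcond; apply: ler_sum => j _.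
  rewrite finset.inE -rk_test /near_rank; set r := rk _ _ _.
  pose k := if o is Some i then K2 z j i else K1 z j; rewrite -/k.
  have : (K0 z <= k <= K0 z + Iu + Ic)%N.
    rewrite /k; have /andP[h1 h2] := hK1 j; case: o {k} => [i|].
      have /andP[h3 h4] := HK j i.
      by rewrite (leq_trans h1 h3) (leq_trans h4) ?leq_add2r.
    by rewrite h1 (leq_trans h2) ?leq_addr.
  move=> /andP[h1 h2]; case: ifP => [_|]; first by rewrite lern1 leq_b1.
  move=> /negbT h; rewrite lern0 eqb0; apply: contra h => /andP[h3 h4].
  by apply/andP; split; lia.
rewrite (rank_bij _ (fun r => (K0 z - Ic.*2 <= r < K0 z + Iu + Ic.*2)%N) tinj) ler_nat.
by apply: leq_trans (card_ord_itv _ _ _) _; lia.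
Qed.

End Core.

(** * Expectation of the false coverage proportion *)

Section Expectation.
Context {R : realType} {n m : nat}.
Variables (alpha t_u t_c : R) (kappa : (n + m).-tuple R -> nat).
Hypothesis alpha01 : 0 < alpha < 1.
Hypothesis kappa_range : forall v, (1 <= kappa v <= m)%N.
Hypothesis mkappa : measurable_fun setT kappa.

Local Notation Z := (config ('I_n + 'I_m)%type _ (R * R)%type).
Local Notation K0 := (K0 kappa).
Local Notation K1 := (K1 t_u kappa).
Local Notation K2 := (K2 t_u t_c kappa).
Local Notation fcp := (fcp alpha kappa).
Local Notation near_rank := (near_rank t_u t_c kappa).
Local Notation stable := (stable t_u t_c kappa).
Local Notation excess := (excess alpha).
Implicit Types (i : 'I_n + 'I_m) (j : 'I_m) (o : option 'I_n).

Lemma measurable_sc i : measurable_fun setT (fun z : Z => sc z i).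
Proof. exact: measurableT_comp measurable_fst (measurable_coord i). Qed.

Lemma measurable_rs i : measurable_fun setT (fun z : Z => rs z i).
Proof. exact: measurableT_comp measurable_snd (measurable_coord i). Qed.

Lemma simple_map_kappa (f : Z -> 'I_n + 'I_m -> R) :
  (forall i, measurable_fun setT (fun z => f z i)) ->
  simple_map (fun z => kappa (stack (f z))).
Proof.
move=> mf; apply: (@simple_map_preimage _ _ _ _ _ kappa (fun z => stack (f z))).
  apply/measurable_fun_tnthP => i.
  rewrite (_ : _ \o _ = fun z => f z (fintype.split i)); first exact: mf.
  by apply/funext => z /=; rewrite tnth_mktuple.
split; last by move=> B; rewrite -[X in measurable X]setTI; exact: mkappa.
apply: (@sub_finite_set _ _ `I_m.+1); last exact: finite_II.
by move=> _ [v _ <-] /=; have /andP[] := kappa_range v.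
Qed.

Lemma simple_map_K0 : simple_map (K0 : Z -> nat).
Proof. by apply: simple_map_kappa => i; exact: measurable_sc. Qed.

Lemma simple_map_K1 j : simple_map (fun z : Z => K1 z j).
Proof.
apply: simple_map_kappa => i; rewrite /replace1; case: eqP => _ //.
exact: measurable_sc.
Qed.

Lemma simple_map_K2 j k : simple_map (fun z : Z => K2 z j k).
Proof.
apply: simple_map_kappa => i; rewrite /replace1.
by case: eqP => _ //; case: eqP => _ //; exact: measurable_sc.
Qed.

Lemma simple_map_sc_lt i i' : simple_map (fun z : Z => (sc z i < sc z i')%R).
Proof. by apply/simple_map_bool/measurable_fun_ltr; exact: measurable_sc. Qed.

Lemma simple_map_rs_lt i i' : simple_map (fun z : Z => (rs z i < rs z i')%R).
Proof. by apply/simple_map_bool/measurable_fun_ltr; exact: measurable_rs. Qed.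

Lemma simple_map_card {I : finType} (b : I -> Z -> bool) :
  (forall x, simple_map (b x)) -> simple_map (fun z => #|[set x | b x z]%SET|).
Proof.
by move=> sb; exact: (simple_map_comp (fun S : {set I} => #|S|)) (simple_map_finset sb).
Qed.

Lemma simple_map_rk j i : simple_map (fun z : Z => rk z j (sc z i)).
Proof.
apply: simple_map_card => l.
exact: (simple_map_comp (andb (l != j)) (simple_map_sc_lt _ _)).
Qed.

Lemma simple_map_excess j o :
  simple_map (fun z : Z => excess z j (K1 z j) o).
Proof.
have sB : simple_map (fun z : Z => below (lr z j) (K1 z j)).
  apply: simple_map_finset => p.
  exact: (simple_map2 ltn) (simple_map_rk _ _) (simple_map_K1 _).
have sY : simple_map (fun z : Z => [set p | (lres z j p < lres z j o)%R]%SET).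
  by apply: simple_map_finset => p; exact: simple_map_rs_lt.
have sM : simple_map (fun z : Z => miss alpha (lres z j) (below (lr z j) (K1 z j)) o).
  rewrite (_ : (fun _ => _) = fun z : Z =>
    (1 - alpha) * #|below (lr z j) (K1 z j)|%:R <= #|below (lr z j) (K1 z j)
       :&: [set p | (lres z j p < lres z j o)%R]%SET|%:R :> R).
    exact: (simple_map2 (fun S S' : {set option 'I_n} =>
      (1 - alpha) * #|S|%:R <= #|S :&: S'|%:R :> R)).
  apply/funext => z; rewrite /miss; congr (_ <= _%:R); apply: eq_card => p.
  by rewrite !finset.inE.
have sL : simple_map (fun z : Z => (lr z j o < K1 z j)%N).
  exact: (simple_map2 ltn) (simple_map_rk _ _) (simple_map_K1 _).
exact: (simple_map2 (fun (q : bool * bool) (k : nat) =>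
  q.1%:R * (q.2%:R - alpha) / k%:R) (simple_map_pair sL sM) (simple_map_K1 j)).
Qed.

Lemma simple_map_near_rank Ic j o i :
  simple_map (fun z : Z => (near_rank Ic z j o (sc z i))%:R : R).
Proof.
have sK : simple_map (fun z : Z => if o is Some k then K2 z j k else K1 z j).
  by case: o => [k|]; [exact: simple_map_K2|exact: simple_map_K1].
exact: (simple_map2 (fun k r : nat =>
  ((k <= r + Ic.*2)%N && (r < k + Ic)%N)%:R : R) sK (simple_map_rk j i)).
Qed.

(** Selection is rewritten through ranks, which involve only finitely many comparisons of scores. *)
Lemma simple_map_selu : simple_map (selu kappa : Z -> {set 'I_m}).
Proof.
rewrite (_ : selu kappa = fun z : Z => [set j | (rk z j (sc z (inr j)) < K0 z)%N]%SET).
  apply: simple_map_finset => j.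
  exact: (simple_map2 ltn) (simple_map_rk _ _) simple_map_K0.
by apply/funext => z; apply/setP => j; rewrite (mem_selu _ kappa_range) finset.inE.
Qed.

Lemma simple_map_selc : simple_map (selc kappa : Z -> {set 'I_n}).
Proof.
(* When [K0 z] equals [m], the order statistic of index m + 1 is out of range and [nth] returns its
   default 0. *)
rewrite (_ : selc kappa = fun z : Z => [set i |
   if (K0 z < m)%N
   then (#|[set l | (sc z (inr l) < sc z (inl i))%R]%SET| < (K0 z).+1)%N
   else sc z (inl i) <= 0]%SET).
  apply: simple_map_finset => i.
  have s0 : simple_map (fun z : Z => sc z (inl i) <= 0).
    apply/simple_map_bool/measurable_fun_ler => //; exact: measurable_sc.
  have s1 : simple_map (fun z : Z => #|[set l | (sc z (inr l) < sc z (inl i))%R]%SET|).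
    by apply: simple_map_card => l; exact: simple_map_sc_lt.
  exact: (simple_map2 (fun (k : nat) (q : nat * bool) =>
    if (k < m)%N then (q.1 < k.+1)%N else q.2) simple_map_K0
    (simple_map_pair s1 s0)).
apply/funext => z; apply/setP => i; rewrite !finset.inE.
case: ltnP => h; first by rewrite le_ordstat.
rewrite /ordstat nth_default//= size_sort size_map size_enum_ord.
exact: h.
Qed.

Lemma simple_map_fcp : simple_map (fcp : Z -> R).
Proof.
have sM : simple_map (fun z : Z => [set j |
    (1 - alpha) * (#|selc kappa z|.+1)%:R
      <= #|[set i in selc kappa z | (rs z (inl i) < rs z (inr j))%R]%SET|%:R :> R]%SET).
  apply: simple_map_finset => j.
  have sY : simple_map (fun z : Z => [set i | (rs z (inl i) < rs z (inr j))%R]%SET).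
    by apply: simple_map_finset => p; exact: simple_map_rs_lt.
  rewrite (_ : (fun _ => _) = fun z : Z =>
    (1 - alpha) * (#|selc kappa z|.+1)%:R <= #|selc kappa z
       :&: [set i | (rs z (inl i) < rs z (inr j))%R]%SET|%:R :> R).
    exact: (simple_map2 (fun S S' : {set 'I_n} =>
      (1 - alpha) * (#|S|.+1)%:R <= #|S :&: S'|%:R :> R) simple_map_selc).
  apply/funext => z; congr (_ <= _%:R); apply: eq_card => p.
  by rewrite !finset.inE.
rewrite (_ : fcp = fun z : Z => #|selu kappa z :&: [set j |
    (1 - alpha) * (#|selc kappa z|.+1)%:R
      <= #|[set i in selc kappa z | (rs z (inl i) < rs z (inr j))%R]%SET|%:R :> R]%SET|%:R
    / (maxn #|selu kappa z| 1)%:R).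
  exact: (simple_map2 (fun S S' : {set 'I_m} =>
    #|S :&: S'|%:R / (maxn #|S| 1)%:R) simple_map_selu sM).
apply/funext => z; rewrite /fcp; congr (_%:R / _); apply: eq_card => j.
by rewrite !finset.inE Qalpha_lt.
Qed.

Variable mu : probability Z R.
Hypothesis exch : forall (s : {perm 'I_n + 'I_m}) (E : set Z), measurable E ->
  mu E = mu (permute s @^-1` E).

Lemma ae_permute (Q : Z -> Prop) s :
  {ae mu, forall z, Q z} -> {ae mu, forall z, Q (permute s z)}.
Proof.
move=> [N [mN N0 QN]]; exists (permute s @^-1` N); split.
- by rewrite -[X in measurable X]setTI; exact: measurable_permute.
- by rewrite -N0; apply/esym/exch.
- by move=> z /= nQ; exact: QN.
Qed.

Lemma Rintegral_permute (f : Z -> R) s : simple_map f ->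
  \int[mu]_z f (permute s z) = \int[mu]_z f z.
Proof.
move=> sf; have sfs : simple_map (f \o permute s).
  exact: simple_map_preimage (measurable_permute s) sf.
congr fine.
have mf : measurable_fun setT (EFin \o f).
  by apply/measurable_EFinP => _ B mB; rewrite setTI; have [_] := sf; exact.
have := @integral_pushforward _ _ _ _ R (permute s) (measurable_permute s) mu
  setT (EFin \o f) mf (simple_map_integrable mu sfs) measurableT.
rewrite preimage_setT => <-; apply: eq_measure_integral => [|mp A mA _].
  exact: measurable_permute.
by rewrite /pushforward /= [RHS](exch s A mA).
Qed.

(** The first [Iu]/b is the cost of [fcp_excess], and (Iu + 4 Ic)/b counts the points of rank near
    the cutoff. The additive 1 of the leave-one-out count, summed over [j] and divided by n + 1,
    gives m/((n + 1) b), and the unequal weights give the last term. *)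
Lemma fcp_expectation (b : R) Iu Ic : 0 < b ->
  {ae mu, forall z, injective (sc z)} -> {ae mu, forall z, injective (rs z)} ->
  {ae mu, forall z, stable b Iu Ic z} ->
  `|\int[mu]_z fcp z - alpha|
    <= Iu%:R / b + (((Iu + 4 * Ic)%N%:R + m%:R / (n.+1)%:R) / b
       + m%:R * (Ic%:R / b ^+ 2)).
Proof.
move=> b0 aes aer aest; set N : R := (n.+1)%:R; set c := Ic%:R / b ^+ 2.
have N0 : N != 0 by rewrite pnatr_eq0.
have N1 : 0 < N^-1 by rewrite invr_gt0 ltr0n.
pose exc j (z : Z) := excess z j (K1 z j) None.
have sexc j : simple_map (exc j) by exact: simple_map_excess.
have sexcs j o : simple_map (fun z => exc j (swap j o z)).
  exact: simple_map_preimage (measurable_permute _) (sexc j).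
have sF := simple_map_fcp.
have sFa : simple_map (fun z => fcp z - alpha).
  exact: (simple_map_comp (fun x => x - alpha)).
have sS : simple_map (fun z => \sum_j exc j z) by exact: simple_map_sum.
have h1 : `|\int[mu]_z (fcp z - alpha - \sum_j exc j z)| <= Iu%:R / b.
  rewrite -[leRHS](Rintegral_prob_cst mu).
  apply: ae_norm_le_Rintegral_simple.
  - exact: (simple_map2 (fun x y => x - y)).
  - exact: simple_map_cst.
  - apply: filterS2 aes aest => z zs zst.
    exact: (fcp_excess _ _ _ _ alpha01 kappa_range _ _ _ _ b0 zst zs).
have eint : \int[mu]_z fcp z - alpha
    = \int[mu]_z (fcp z - alpha - \sum_j exc j z) + \sum_j \int[mu]_z exc j z.
  rewrite RintegralB//; try exact: simple_map_integrable.
  rewrite RintegralB//; try exact: simple_map_integrable.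
    by rewrite Rintegral_prob_cst Rintegral_simple_sum// subrK.
  exact/simple_map_integrable/simple_map_cst.
rewrite eint; apply: (le_trans (ler_normD _ _)); apply: lerD h1 _.
pose nr j o : R := \int[mu]_z (near_rank Ic z j o (sc z (inr j)))%:R.
have hj j : `|\int[mu]_z exc j z| <= N^-1 * ((\sum_o nr j o + 1) / b + N * c).
  (* By exchangeability the n + 1 exchanged terms have equal integrals, so each equals their
     average. *)
  have -> : \int[mu]_z exc j z = N^-1 * \int[mu]_z (\sum_o exc j (swap j o z)).
    rewrite Rintegral_simple_sum//.
    under eq_bigr do rewrite Rintegral_permute//.
    rewrite sumr_const card_option card_ord -[X in _ = _ * X]mulr_natl.
    by rewrite mulrA mulVf// mul1r.
  rewrite normrM gtr0_norm// ler_pM2l//.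
  pose nz (z : Z) : R := \sum_o (near_rank Ic z j o (sc z (pt j o)))%:R.
  have snz : simple_map nz.
    by apply: simple_map_sum => o; exact: simple_map_near_rank.
  have -> : (\sum_o nr j o + 1) / b + N * c = \int[mu]_z ((nz z + 1) / b + N * c).
    have snz1 : simple_map (fun z => nz z + 1).
      exact: (simple_map_comp (fun x => x + 1)).
    have snzb : simple_map (fun z => (nz z + 1) / b).
      exact: (simple_map_comp (fun x => x / b)).
    rewrite RintegralD//; try exact: simple_map_integrable; last first.
      exact/simple_map_integrable/simple_map_cst.
    rewrite Rintegral_prob_cst RintegralZr//; last exact: simple_map_integrable.
    rewrite RintegralD//; try exact: simple_map_integrable; last first.
      exact/simple_map_integrable/simple_map_cst.
    rewrite Rintegral_prob_cst Rintegral_simple_sum; last first.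
      by move=> o; exact: simple_map_near_rank.
    (* A second exchange: the cutoff and the rank function are invariant, and the score of [o]
       becomes that of the test point [j]. *)
    have -> // : \sum_o nr j o
        = \sum_o \int[mu]_z (near_rank Ic z j o (sc z (pt j o)))%:R.
    apply: eq_bigr => o _; rewrite /nr.
    rewrite -(Rintegral_permute _ (tperm (inr j) (pt j o))); last first.
      exact: simple_map_near_rank.
    by apply: eq_Rintegral => z _; rewrite near_rank_swap sc_swap.
  apply: ae_norm_le_Rintegral_simple.
  - exact: simple_map_sum.
  - exact: (simple_map_comp (fun x => (x + 1) / b + N * c)).
  - have aeo : {ae mu, forall z, forall o, stable b Iu Ic (swap j o z)}.
      by apply: filter_forall => o; exact: ae_permute.
    apply: filterS2 aer aeo => z zr zst.
    exact: (sum_excess_swap _ _ _ _ alpha01 _ _ _ _ _ b0 zst zr).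
apply: (le_trans (ler_norm_sum _ _ _)).
apply: (le_trans (ler_sum _ (fun j _ => hj j))).
(* Summing over [j] first, [sum_near_rank] applies to each of the n + 1 labels [o]. *)
have hnr : \sum_j \sum_o nr j o <= N * (Iu + 4 * Ic)%N%:R.
  rewrite exchange_big /= mulr_natl -[X in _ *+ X](card_ord n.+1).
  have -> : #|'I_n.+1| = #|{: option 'I_n}| by rewrite card_option !card_ord.
  rewrite -sumr_const; apply: ler_sum => o _.
  rewrite -Rintegral_simple_sum; last by move=> j; exact: simple_map_near_rank.
  rewrite -[leRHS](Rintegral_prob_cst mu).
  apply: ae_le_Rintegral_simple.
  - by apply: simple_map_sum => j; exact: simple_map_near_rank.
  - exact: simple_map_cst.
  - apply: filterS2 aes aest => z zs zst; exact: (sum_near_rank _ _ _ b Iu).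
rewrite -mulr_sumr big_split /= -mulr_suml big_split /= !sumr_const card_ord.
rewrite -[N * c *+ m]mulr_natl.
have -> : (Iu + 4 * Ic)%N%:R + m%:R / N = N^-1 * (N * (Iu + 4 * Ic)%N%:R + m%:R).
  by field.
have -> : m%:R * c = N^-1 * (m%:R * (N * c)) by field.
by rewrite -mulrA -mulrDr ler_pM2l// lerD2r ler_pM2r ?invr_gt0// lerD2r.
Qed.

End Expectation.

(** * Conclusion *)

Section Transfer.
Context {R : realType} {d d' : measure_display} {Omega : measurableType d}
  {T : measurableType d'} {P : probability Omega R}.

(** Simplicity of [f] makes the exceptional set measurable, so its being negligible passes to the
    law of [Z]. *)
Lemma ae_distribution_simple (Z : {mfun Omega >-> T}) {A : Type} (f : T -> A)
    (B : set A) : simple_map f -> {ae P, forall w, B (f (Z w))} ->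
  {ae distribution P Z, forall z, B (f z)}.
Proof.
move=> [_ mf] aeB; exists (f @^-1` (~` B)); split => //.
rewrite /distribution /pushforward /=; apply/negligibleP => //.
by rewrite -[X in measurable X]setTI; apply: measurable_funPT => //; exact: mf.
Qed.

Lemma mutually_independent_comp {I : finType} {d2} {T2 : measurableType d2}
    (Z : I -> Omega -> T) (phi : T -> T2) : measurable_fun setT phi ->
  mutually_independent P Z -> mutually_independent P (fun i w => phi (Z i w)).
Proof.
move=> mphi indep A mA; apply: (indep (fun i => phi @^-1` A i)) => i.
by rewrite -[X in measurable X]setTI; exact: mphi.
Qed.

Lemma identically_distributed_comp {I : Type} {d2} {T2 : measurableType d2}
    (Z : I -> Omega -> T) (phi : T -> T2) : measurable_fun setT phi ->
  identically_distributed P Z ->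
  identically_distributed P (fun i w => phi (Z i w)).
Proof.
move=> mphi ident i j A mA; apply: (ident i j (phi @^-1` A)).
by rewrite -[X in measurable X]setTI; exact: mphi.
Qed.

Lemma ae_injective_independent {I : finType} (Z : I -> Omega -> R) :
  (forall k, measurable_fun setT (Z k)) -> mutually_independent P Z ->
  (forall k, continuous_rv P (Z k)) ->
  {ae P, forall w, forall i j, i != j -> Z i w != Z j w}.
Proof.
move=> mZ indep cont.
apply: filter_forall => i; apply: filter_forall => j.
have [->|ij] := eqVneq i j; first exact: aeW.
exists [set w | Z i w = Z j w]; split.
- rewrite (_ : [set _ | _] = setT `&` (fun w => Z i w == Z j w) @^-1` [set true]).
    exact: measurable_fun_eqr.
  by rewrite setTI; apply/seteqP; split => w /= /eqP.
- exact: independent_pair_neq.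
- by move=> w /= h; apply/eqP/negbNE/negP => ne; apply: h.
Qed.

End Transfer.

(** * Interval membership and the final rate *)

Section Final.
Context {R : realType}.

Lemma in_PI_dist (c q y : R) : in_PI c q%:E y = (`|y - c| <= q).
Proof. by rewrite /in_PI -EFinB -EFinD !lee_fin ler_distl. Qed.

Lemma not_in_PI (alpha c y : R) {I : finType} (S : {set I}) (r : I -> R) :
  ~~ in_PI c (Qalpha alpha S r) y = (Qalpha alpha S r < `|y - c|%:E)%E.
Proof.
rewrite /Qalpha; case: ifP => _; first by rewrite /in_PI /= leNye leey ltNge leey.
by rewrite in_PI_dist lte_fin ltNge.
Qed.

Lemma half_le_ln (k : nat) : (2 <= k)%N -> 2^-1 <= ln k%:R :> R.
Proof.
move=> k2; apply: (@le_trans _ _ (ln 2)).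
  (* ln(1 + x) <= x at x = -1/2 gives ln 2 >= 1/2. *)
  have := @le_ln1Dx R (- 2^-1) ltac:(lra).
  have -> : 1 + - 2^-1 = 2^-1 :> R by lra.
  by rewrite lnV ?posrE// lerN2.
by rewrite ler_ln ?posrE ?ltr0n ?ler_nat//; lia.
Qed.

(** Each logarithm is at least 1/2, which costs a factor 2, and both 1/gamma and 1/gamma^2 are at
    most 1/(rho gamma^3). The constant 10 = 2 (4 + 1) comes from the two [Ic] terms; the other terms
    need at most 4. *)
Lemma rate_bound (Iu Ic n m : nat) (gamma rho : R) :
  (2 <= n)%N -> (2 <= m)%N -> 0 < gamma < 1 -> 0 < rho < 1 ->
  Iu%:R / (gamma * m%:R) + (((Iu + 4 * Ic)%N%:R + m%:R / (n.+1)%:R) / (gamma * m%:R)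
       + m%:R * (Ic%:R / (gamma * m%:R) ^+ 2))
  <= 10 * ((rho * gamma ^+ 3)^-1 * (Ic%:R * ln m%:R / m%:R + ln n%:R / n%:R)
            + Iu%:R * ln m%:R / (m%:R * gamma)).
Proof.
move=> n2 m2 /andP[g0 g1] /andP[r0 r1].
have Ln := half_le_ln _ n2; have Lm := half_le_ln _ m2.
have m0 : 0 < m%:R :> R by rewrite ltr0n; lia.
have n0 : 0 < n%:R :> R by rewrite ltr0n; lia.
have nn : n%:R != 0 :> R by rewrite gt_eqF.
have mn : m%:R != 0 :> R by rewrite gt_eqF.
have gn : gamma != 0 by rewrite gt_eqF.
have rn : rho != 0 by rewrite gt_eqF.
have : 0 < n.+1%:R :> R by rewrite ltr0n.
have : n%:R <= n.+1%:R :> R by rewrite ler_nat leqnSn.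
set N := n.+1%:R => nN N0; have Nn : N != 0 by rewrite gt_eqF.
clearbody N.
set X := (rho * gamma ^+ 3)^-1.
have g2 : gamma ^- 2 <= X.
  rewrite lef_pV2 ?posrE ?mulr_gt0 ?exprn_gt0// exprS mulrA.
  by rewrite ger_pMl ?exprn_gt0// mulr_ile1// ltW.
have gX : gamma^-1 <= X.
  apply: le_trans g2; rewrite lef_pV2 ?posrE ?exprn_gt0//.
  by rewrite expr2 ger_pMl// ltW.
have X0 : 0 < X by apply: lt_le_trans gX; rewrite invr_gt0.
have hu : Iu%:R / (m%:R * gamma) <= 2 * (Iu%:R * ln m%:R / (m%:R * gamma)).
  rewrite [leRHS]mulrA ler_pM2r ?invr_gt0 ?mulr_gt0//.
  by rewrite [leRHS]mulrCA -[leLHS]mulr1 ler_wpM2l//; lra.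
have hc (Y : R) : 0 < Y -> Y <= X ->
    Y * (Ic%:R / m%:R) <= 2 * (X * (Ic%:R * ln m%:R / m%:R)).
  move=> Y0 YX; rewrite [leRHS]mulrCA; apply: ler_pM => //; first exact: ltW.
  rewrite [leRHS]mulrA ler_pM2r ?invr_gt0//.
  by rewrite [leRHS]mulrCA -[leLHS]mulr1 ler_wpM2l//; lra.
have hn : gamma^-1 * N^-1 <= 2 * (X * (ln n%:R / n%:R)).
  rewrite [leRHS]mulrCA; apply: ler_pM; rewrite ?invr_ge0 ?(ltW g0) ?(ltW N0)//.
  rewrite mulrA; apply: (@le_trans _ _ (1 * n%:R^-1)).
    by rewrite mul1r lef_pV2 ?posrE.
  by rewrite ler_pM2r ?invr_gt0//; lra.
have hc1 := hc _ _ gX; have hc2 := hc _ _ g2.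
rewrite invr_gt0 in hc1; have {}hc1 := hc1 g0.
rewrite invr_gt0 exprn_gt0// in hc2; have {}hc2 := hc2 isT.
have -> : Iu%:R / (gamma * m%:R) + (((Iu + 4 * Ic)%N%:R + m%:R / N) / (gamma * m%:R)
       + m%:R * (Ic%:R / (gamma * m%:R) ^+ 2))
  = 2 * (Iu%:R / (m%:R * gamma)) + 4 * (gamma^-1 * (Ic%:R / m%:R))
    + gamma^-1 * N^-1 + gamma ^- 2 * (Ic%:R / m%:R).
  rewrite natrD natrM; field.
  by rewrite ?mn ?gn ?Nn.
have hu0 : 0 <= Iu%:R * ln m%:R / (m%:R * gamma).
  by rewrite divr_ge0 ?mulr_ge0 ?(ltW m0) ?(ltW g0)//; lra.
have hn0 : 0 <= X * (ln n%:R / n%:R).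
  by rewrite mulr_ge0 ?(ltW X0)// divr_ge0//; lra.
have hc0 : 0 <= X * (Ic%:R * ln m%:R / m%:R).
  by rewrite mulr_ge0 ?(ltW X0)// divr_ge0// mulr_ge0//; lra.
rewrite [in leRHS]mulrDr; lra.
Qed.
End Final.

Theorem theorem3 (R : realType) :
  exists C : R, 0 < C /\
  forall (dd : nat) (d : measure_display) (Omega : measurableType d)
    (P : probability Omega R) (n m : nat) (alpha : R)
    (muhat g : dd.-tuple R -> R)
    (X : 'I_n + 'I_m -> Omega -> dd.-tuple R) (Y : 'I_n + 'I_m -> Omega -> R)
    (kappa : (n + m).-tuple R -> nat)
    (t_u t_c : R) (I_u I_c : nat) (gamma rho : R),
    (2 <= n)%N ->
    0 < alpha < 1 ->
    measurable_fun setT muhat -> measurable_fun setT g ->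
    (forall i, measurable_fun setT (X i)) -> (forall i, measurable_fun setT (Y i)) ->
    (* (X_i, Y_i), i in C u U, are i.i.d. *)
    mutually_independent P (fun i w => (X i w, Y i w)) ->
    identically_distributed P (fun i w => (X i w, Y i w)) ->
    (* scores and residuals are continuous random variables *)
    (forall i, continuous_rv P (score g X i)) ->
    (forall i, continuous_rv P (resid muhat X Y i)) ->
    (* kappa : R^(n+m) -> {1,...,m} deterministic measurable *)
    measurable_fun setT kappa ->
    (forall v, (1 <= kappa v <= m)%N) ->
    (* Assumption (A) *)
    0 < gamma < 1 ->
    {ae P, forall w,
      (forall j, j \in Su g X kappa w ->
         khat1 g X kappa w j t_u = khat g X kappa w) /\
      (forall j, j \notin Su g X kappa w ->
         (khat g X kappa w <= khat1 g X kappa w j t_u <= khat g X kappa w + I_u)%N) /\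
      (forall j k,
         (khat1 g X kappa w j t_u <= khat2 g X kappa w j k t_u t_c
            <= khat1 g X kappa w j t_u + I_c)%N) /\
      (Num.ceil (gamma * m%:R) <= (khat g X kappa w)%:Z)%R /\
      (khat g X kappa w <= m.-1)%N} ->
    (* Assumption (B) *)
    0 < rho < 1 ->
    (forall i (t r : R), gamma / 2 <= t <= 1 -> 0 < r < 1 ->
       derivable (fun r' => joint_cdf P (resid muhat X Y i) (score g X i) r' t) r 1 /\
       rho * t <= derive1 (fun r' => joint_cdf P (resid muhat X Y i) (score g X i) r' t) r) ->
    256 * ln n%:R <= n%:R * gamma ->
    32 * ln m%:R <= m%:R * gamma ->
    (`| FCR alpha muhat g X Y kappa P - alpha%:E | <=
      (C * ((rho * gamma ^+ 3)^-1 * (I_c%:R * ln m%:R / m%:R + ln n%:R / n%:R)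
            + I_u%:R * ln m%:R / (m%:R * gamma)))%:E)%E.
Proof.
exists 10; split => // dd d Omega P n m alpha muhat g X Y kappa t_u t_c I_u I_c
  gamma rho n2 a01 mmu mg mX mY indep ident contS contR mk kr g01 aeA r01 _ _ _.
have /andP[g0 g1] := g01.
(* Score and residual form one measurable function of (X_i, Y_i), so these pairs are again i.i.d.
   and the problem passes to the law [mu] of the configuration [Z]. *)
pose phi (p : dd.-tuple R * R) : R * R := (g p.1, `|p.2 - muhat p.1|).
have mphi : measurable_fun setT phi.
  apply: measurable_fun_pair; first exact: measurableT_comp mg measurable_fst.
  apply: measurableT_comp; first exact: normr_measurable.
  apply: measurable_funB; first exact: measurable_snd.
  exact: measurableT_comp mmu measurable_fst.
pose zf w : config ('I_n + 'I_m)%type _ (R * R)%type := fun i => phi (X i w, Y i w).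
have mzf i : measurable_fun setT (fun w => zf w i).
  by apply: measurableT_comp mphi _; apply: measurable_fun_pair.
pose Z : {mfun Omega >-> config ('I_n + 'I_m)%type _ (R * R)%type} :=
  HB.pack zf (isMeasurableFun.Build _ _ _ _ zf (measurable_to_config _ mzf)).
have indepZ : mutually_independent P (fun i w => Z w i).
  exact: mutually_independent_comp mphi indep.
have identZ : identically_distributed P (fun i w => Z w i).
  exact: identically_distributed_comp mphi ident.
pose mu := distribution P Z.
have exch (s : {perm 'I_n + 'I_m}) (E : set (config ('I_n + 'I_m)%type _ (R * R)%type)) :
    measurable E -> mu E = mu (permute s @^-1` E).
  exact: exchangeable_iid.
have aesc : {ae mu, forall z, injective (sc z)}.
  suff h : {ae mu, forall z, forall i j, i != j -> sc z i != sc z j}.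
    by apply: filterS h => z hz i j; apply: contra_eq => ij; exact: hz.
  have h := ae_injective_independent (fun i w => sc (Z w) i)
    (fun i => measurableT_comp (measurable_sc i) (measurable_funPT Z))
    (mutually_independent_comp _ _ measurable_fst indepZ) contS.
  apply: filter_forall => i; apply: filter_forall => j.
  apply: (ae_distribution_simple Z (fun z => sc z i != sc z j) [set b | i != j -> b]).
    apply: (simple_map_comp negb); apply/simple_map_bool/measurable_fun_eqr;
    exact: measurable_sc.
  by apply: filterS h => w hw; exact: hw.
have aers : {ae mu, forall z, injective (rs z)}.
  suff h : {ae mu, forall z, forall i j, i != j -> rs z i != rs z j}.
    by apply: filterS h => z hz i j; apply: contra_eq => ij; exact: hz.
  have h := ae_injective_independent (fun i w => rs (Z w) i)
    (fun i => measurableT_comp (measurable_rs i) (measurable_funPT Z))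
    (mutually_independent_comp _ _ measurable_snd indepZ) contR.
  apply: filter_forall => i; apply: filter_forall => j.
  apply: (ae_distribution_simple Z (fun z => rs z i != rs z j) [set b | i != j -> b]).
    apply: (simple_map_comp negb); apply/simple_map_bool/measurable_fun_eqr;
    exact: measurable_rs.
  by apply: filterS h => w hw; exact: hw.
(* An almost sure event is nonempty, and at one of its points 1 <= khat <= m - 1. *)
have m2 : (2 <= m)%N.
  have pf : ProperFilter (almost_everywhere P).
    have P0 : (0 < P setT)%E by rewrite probability_setT lte01.
    exact: ae_properfilter_algebraOfSetsType P0.
  have [w [_ [_ [_ [_ km]]]]] := filter_ex aeA.
  by have /andP[k1 _] := kr (stack (scores g X w)); rewrite /khat in km; lia.
have b0 : 0 < gamma * m%:R by rewrite mulr_gt0// ltr0n; lia.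
have sK0 := simple_map_K0 kappa kr mk.
have sK1 := simple_map_K1 t_u kappa kr mk.
have sK2 := simple_map_K2 t_u t_c kappa kr mk.
have sSu := simple_map_selu kappa kr mk.
(* Each clause of (A), for fixed indices, is a property of a simple map and so transfers to [mu];
   the finitely many indices are then intersected. *)
have ae1 : {ae mu, forall z, forall j,
    j \in selu kappa z -> K1 t_u kappa z j = K0 kappa z}.
  apply: filter_forall => j.
  apply: (ae_distribution_simple Z
    (fun z => (selu kappa z, (K1 t_u kappa z j, K0 kappa z)))
    [set q : {set 'I_m} * (nat * nat) | j \in q.1 -> q.2.1 = q.2.2]).
    exact: simple_map_pair sSu (simple_map_pair (sK1 j) sK0).
  by apply: filterS aeA => w [h _]; exact: h.
have ae2 : {ae mu, forall z, forall j, j \notin selu kappa z ->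
    (K0 kappa z <= K1 t_u kappa z j <= K0 kappa z + I_u)%N}.
  apply: filter_forall => j.
  apply: (ae_distribution_simple Z
    (fun z => (selu kappa z, (K1 t_u kappa z j, K0 kappa z)))
    [set q : {set 'I_m} * (nat * nat) | j \notin q.1 -> (q.2.2 <= q.2.1 <= q.2.2 + I_u)%N]).
    exact: simple_map_pair sSu (simple_map_pair (sK1 j) sK0).
  by apply: filterS aeA => w [_ [h _]]; exact: h.
have ae3 : {ae mu, forall z, forall j k,
    (K1 t_u kappa z j <= K2 t_u t_c kappa z j k <= K1 t_u kappa z j + I_c)%N}.
  apply: filter_forall => j; apply: filter_forall => k.
  apply: (ae_distribution_simple Z
    (fun z => (K1 t_u kappa z j, K2 t_u t_c kappa z j k))
    [set q : nat * nat | (q.1 <= q.2 <= q.1 + I_c)%N]).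
    exact: simple_map_pair (sK1 j) (sK2 j k).
  by apply: filterS aeA => w [_ [_ [h _]]]; exact: h.
have ae4 : {ae mu, forall z, gamma * m%:R <= (K0 kappa z)%:R
    /\ (K0 kappa z <= m.-1)%N}.
  apply: (ae_distribution_simple Z (K0 kappa)
    [set k : nat | gamma * m%:R <= k%:R /\ (k <= m.-1)%N]) => //.
  apply: filterS aeA => w [_ [_ [_ [hk km]]]]; split => //.
  apply: le_trans (ceil_ge _) _; rewrite -[leRHS]/((Posz _)%:~R) ler_int.
  exact: hk.
have aest : {ae mu, forall z, stable t_u t_c kappa (gamma * m%:R) I_u I_c z}.
  apply: filterS (filterI ae1 (filterI ae2 (filterI ae3 ae4))).
  by move=> z [h1 [h2 [h3 h4]]].
have sF := simple_map_fcp alpha kappa a01 kr mk.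
have FE : FCR alpha muhat g X Y kappa P = (\int[mu]_z fcp alpha kappa z)%:E.
  have FCPE w : FCP alpha muhat g X Y kappa w = fcp alpha kappa (Z w).
    rewrite /FCP /fcp; congr (_%:R / _); apply: eq_card => j.
    by rewrite !finset.inE; congr (_ && _); exact: not_in_PI.
  rewrite /FCR; under eq_integral do rewrite FCPE.
  rewrite fineK; last exact: integrable_fin_num (simple_map_integrable mu sF).
  rewrite (@integral_distribution _ _ _ _ R P Z (EFin \o fcp alpha kappa))//.
    by apply/measurable_EFinP => _ B mB; rewrite setTI; have [_] := sF; exact.
  apply: (@simple_map_integrable _ _ _ P (fcp alpha kappa \o Z)).
  exact: simple_map_preimage (measurable_funPT Z) sF.
rewrite FE -EFinB lee_fin.
apply: le_trans (fcp_expectation _ _ _ _ a01 kr mk mu exch _ _ _ b0 aesc aers aest) _.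
exact: rate_bound.
Qed.
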